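(* Let $Q_0:\mathcal M\to\mathcal M$ be a map and $\alpha\in(0,1)$ a constant such that: (i) if $u_k\in\mathcal M$ converge to $u\in\mathcal M$ uniformly on every bounded interval, then $Q_0[u_k]\to Q_0[u]$ almost everywhere; (ii) $u_1\le u_2$ (pointwise) implies $Q_0[u_1]\le Q_0[u_2]$ for all $u_1,u_2\in\mathcal M$; (iii) $T_{x_0}Q_0=Q_0T_{x_0}$ for all $x_0\in\mathbb R$, where $(T_{x_0}[u])(\cdot)=u(\cdot-x_0)$; (iv) $Q_0[\alpha]=\alpha$, and for constant functions $\gamma$: $0<\gamma<\alpha$ implies $Q_0[\gamma]<\gamma$, and $\alpha<\gamma<1$ implies $\gamma<Q_0[\gamma]$; (v) whenever constants $c_-,c_+$ and $\phi_-,\phi_+\in\mathcal M$ satisfy $(Q_0[\phi_-])(x-c_-)\equiv\phi_-(x)$, $\phi_-(-\infty)=0$, $\phi_-(+\infty)=\alpha$, $(Q_0[\phi_+])(x-c_+)\equiv\phi_+(x)$, $\phi_+(-\infty)=\alpha$, $\phi_+(+\infty)=1$, one has $c_-<c_+$. Suppose a constant $\underline c$ and $\underline\psi\in\mathcal M$ with $\underline\psi(0)=0$ and $\underline\psi(+\infty)\in(\alpha,1]$ satisfy $\underline\psi(x)\le(Q_0[\underline\psi])(x-\underline c)$ for all $x$, and a constant $\overline c$ and $\overline\psi\in\mathcal M$ with $\overline\psi(-\infty)\in[0,\alpha)$ and $\overline\psi(0)=1$ satisfy $(Q_0[\overline\psi])(x-\overline c)\le\overline\psi(x)$ for all $x$.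 Then there exist $c\in[\underline c,\overline c]$ and $\phi\in\mathcal M$ with $\phi(-\infty)=0$, $\phi(+\infty)=1$ such that $(Q_0[\phi])(x-c)\equiv\phi(x)$.
   Context: $\mathcal M$ denotes the set of monotone nondecreasing, left continuous functions $u$ on $\mathbb R$ with $0\le u\le 1$. Constants are regarded as constant functions in $\mathcal M$. *)

(* Defs.v *)
From HB Require Import structures.
From mathcomp Require Import all_boot all_order all_algebra.
From mathcomp Require Import all_classical all_reals all_analysis.
Set Implicit Arguments. Unset Strict Implicit. Unset Printing Implicit Defensive.
Import Order.TTheory GRing.Theory Num.Theory.
Import numFieldNormedType.Exports.
Local Open Scope classical_set_scope.
Local Open Scope ring_scope.

Definition inM {R : realType} (u : R -> R) : Prop :=
  (forall x y : R, x <= y -> u x <= u y) /\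
  (forall x : R, u y @[y --> at_left x] --> u x) /\
  (forall x : R, 0 <= u x <= 1).

Definition transl {R : realType} (x0 : R) (u : R -> R) : R -> R :=
  fun x => u (x - x0).

Definition unif_cvg_bounded {R : realType} (uk : nat -> R -> R) (u : R -> R) : Prop :=
  forall a b : R, forall eps : R, 0 < eps ->
    \forall k \near \oo, forall x : R, a <= x <= b -> `|uk k x - u x| < eps.

Definition lim_minf {R : realType} (u : R -> R) (l : R) : Prop :=
  u x @[x --> -oo] --> l.
Definition lim_pinf {R : realType} (u : R -> R) (l : R) : Prop :=
  u x @[x --> +oo] --> l.

(* Main.v *)
(* For each large n and each speed c, the equation is solved on a window with
   the values 0 on x <= -n and 1 on x > n imposed. By comparison with the given
   subsolution (supersolution), every solution exceeds (stays below) a fixed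
   level b < alpha at the origin when c is smaller (larger) than the given
   speed, so there are two arbitrarily close speeds in between with solutions u-
   and u+ which are respectively above and below b at 0. Let n go to infinity.
   The distance between the crossings of b and of a level b' > alpha stays
   bounded: otherwise, recentring at the two crossings would give a subsolution
   from 0 to alpha and a supersolution from alpha to 1 of the same speed, both
   of which can be upgraded to genuine waves, contradicting (v). Hence recentred
   limits of u- and u+ connect 0 to 1; each is either a wave, or a subsolution
   vanishing near -oo, resp. a supersolution equal to 1 near +oo, because it sticks
   to an end of the window. In the last case some translate of the supersolution
   dominates the subsolution, and there is a fixed point in between.

   Instead of extracting subsequences by Helly's theorem, all limits are taken
   along one nonprincipal ultrafilter U on nat. *)
Require Import Defs.
From HB Require Import structures.
From mathcomp Require Import all_boot all_order all_algebra.
From mathcomp Require Import all_classical all_reals all_analysis.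
From mathcomp Require Import ring lra.
Import Order.TTheory GRing.Theory Num.Theory.
Import numFieldNormedType.Exports.
Local Open Scope classical_set_scope.
Local Open Scope ring_scope.

(** * Monotone left continuous functions *)

Section MonotoneFunctions.
Set Implicit Arguments. Unset Strict Implicit.
Variable R : realType.
Implicit Types (u v w : R -> R) (x y a b c e l m : R).

(** For a monotone function a single point [y < x] with [u x < u y + e] already controls the whole
    interval between them. This form replaces filters by inequalities and suits suprema. *)
Lemma inMP u : inM u <-> [/\ forall x y, x <= y -> u x <= u y,
  forall x e, 0 < e -> exists2 y, y < x & u x < u y + e &
  forall x, 0 <= u x <= 1].
Proof.
split=> [[mu [lu bu]]|[mu lu bu]].
  split=> // x e e0.
  have /cvgrPdist_lt /(_ e e0) := lu x.
  rewrite near_withinE => -[d /= d0 dP].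
  exists (x - d / 2); first by lra.
  suff : `|u x - u (x - d / 2)| < e by rewrite ltr_norml; lra.
  by apply: dP => /=; [rewrite ltr_norml|]; lra.
split=> //; split=> // x; apply/cvgrPdist_lt => e e0.
have [y yx uy] := lu x e e0.
near=> z.
have zx : z < x by near: z; exact: nbhs_left_lt.
have yz : y < z by near: z; exact: nbhs_left_gt.
have := mu _ _ (ltW zx); have := mu _ _ (ltW yz).
by move=> ? ?; rewrite ger0_norm; lra.
Unshelve. all: by end_near. Qed.

Lemma inM_ndecr u : inM u -> forall x y, x <= y -> u x <= u y.
Proof. by case. Qed.

Lemma inM_left u : inM u -> forall x e, 0 < e -> exists2 y, y < x & u x < u y + e.
Proof. by case/inMP. Qed.

Lemma inM_ge0 u : inM u -> forall x, 0 <= u x.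
Proof. by case=> _ [_ h] x; case/andP: (h x). Qed.

Lemma inM_le1 u : inM u -> forall x, u x <= 1.
Proof. by case=> _ [_ h] x; case/andP: (h x). Qed.

Lemma inM_le_left u x a : inM u -> (forall y, y < x -> u y <= a) -> u x <= a.
Proof.
move=> uM ua; apply/ler_addgt0Pr => e e0.
by have [y /ua uy uxy] := inM_left uM x e0; lra.
Qed.

Lemma inM_cst a : 0 <= a <= 1 -> inM (fun=> a : R).
Proof. by move=> a01; apply/inMP; split=> // x e e0; exists (x - 1); lra. Qed.

Lemma inM_transl c u : inM u -> inM (transl c u).
Proof.
rewrite /transl => uM; apply/inMP; split=> [x y xy|x e e0|x].
- by apply: (inM_ndecr uM); lra.
- have [y yx uy] := inM_left uM (x - c) e0.
  by exists (y + c); [lra | rewrite addrK].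
- by rewrite (inM_ge0 uM) (inM_le1 uM).
Qed.

Lemma inM_max u v : inM u -> inM v -> inM (fun x => Num.max (u x) (v x)).
Proof.
move=> uM vM; apply/inMP; split=> [x y xy|x e e0|x].
- by rewrite ge_max !le_max (inM_ndecr uM xy) (inM_ndecr vM xy) orbT.
- have [y yx uy] := inM_left uM x e0.
  have [z zx vz] := inM_left vM x e0.
  exists (Num.max y z); first by rewrite gt_max yx.
  have yM : y <= Num.max y z by rewrite le_max lexx.
  have zM : z <= Num.max y z by rewrite le_max lexx orbT.
  have := inM_ndecr uM yM; have := inM_ndecr vM zM.
  by rewrite addr_maxl gt_max !lt_max => *; apply/andP; split; apply/orP; [left|right]; lra.
- by rewrite ge_max le_max !(inM_ge0 uM) !(inM_le1 uM) (inM_le1 vM).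
Qed.

Lemma inM_min u v : inM u -> inM v -> inM (fun x => Num.min (u x) (v x)).
Proof.
move=> uM vM; apply/inMP; split=> [x y xy|x e e0|x].
- by rewrite le_min !ge_min (inM_ndecr uM xy) (inM_ndecr vM xy) orbT.
- have [y yx uy] := inM_left uM x e0.
  have [z zx vz] := inM_left vM x e0.
  exists (Num.max y z); first by rewrite gt_max yx.
  have yM : y <= Num.max y z by rewrite le_max lexx.
  have zM : z <= Num.max y z by rewrite le_max lexx orbT.
  have := inM_ndecr uM yM; have := inM_ndecr vM zM.
  by rewrite addr_minl lt_min !gt_min => *; apply/andP; split; apply/orP; [left|right]; lra.
- by rewrite le_min ge_min !(inM_ge0 uM) !(inM_le1 uM) (inM_ge0 vM).
Qed.

(** The value 0 at the jump itself is what left continuity demands. *)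
Definition step a : R -> R := fun x => if x <= a then 0 else 1.

Lemma inM_step a : inM (step a).
Proof.
rewrite /step; apply/inMP; split=> [x y xy|x e e0|x]; last by case: ifP; lra.
- by case: (leP x a) => hx; case: (leP y a) => hy //; lra.
- case: (leP x a) => hx; first by exists (x - 1); [lra|case: ifP; lra].
  exists ((x + a) / 2); first by lra.
  by rewrite leNgt (_ : a < _) /=; lra.
Qed.

(* Knaster-Tarski: a pointwise supremum of left continuous monotone functions
   is again left continuous, so [M] is a complete lattice. *)
Lemma fixpoint_between (F : (R -> R) -> R -> R) u v :
  (forall w, inM w -> inM (F w)) ->
  (forall w w', inM w -> inM w' -> (forall x, w x <= w' x) ->
    forall x, F w x <= F w' x) ->
  inM u -> inM v -> (forall x, u x <= v x) ->
  (forall x, u x <= F u x) -> (forall x, F v x <= v x) ->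
  exists w, [/\ inM w, forall x, F w x = w x, forall x, u x <= w x &
    forall x, w x <= v x].
Proof.
move=> FM Fle uM vM uv uF vF.
pose A w := [/\ inM w, forall x, w x <= F w x & forall x, w x <= v x].
pose E x := [set t | exists2 w, A w & t = w x].
have Au : A u by [].
have E0 x : E x !=set0 by exists (u x), u.
have Ev x : ubound (E x) (v x) by move=> _ [w [_ _ wv] ->].
pose s x := sup (E x).
have Es w x : A w -> w x <= s x.
  by move=> Aw; apply: ub_le_sup; [exists (v x)|exists w].
have sle x t : (forall w, A w -> w x <= t) -> s x <= t.
  by move=> h; apply: ge_sup => // _ [w Aw ->]; exact: h.
have sv x : s x <= v x by apply: sle => w [].
have sM : inM s.
  apply/inMP; split=> [x y xy|x e e0|x].
  - apply: sle => w Aw; apply: (le_trans _ (Es _ y Aw)).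
    by case: Aw => wM _ _; exact: inM_ndecr.
  - have e20 : 0 < e / 2 by lra.
    have [|_ [w Aw ->] hw] := @sup_adherent _ (E x) _ e20.
      by split=> //; exists (v x).
    have [wM _ _] := Aw; have [y yx hy] := inM_left wM x e20.
    by exists y => //; have := Es _ y Aw; rewrite -/(s x) in hw; lra.
  - rewrite (le_trans (inM_ge0 uM x)) ?Es//=.
    by apply: (le_trans (sv x)); exact: inM_le1.
have sF x : s x <= F s x.
  apply: sle => w Aw; have [wM wF _] := Aw; apply: (le_trans (wF x)).
  by apply: Fle => // y; exact: Es.
have Fs x : F s x <= s x.
  apply: (@Es (F s)); split=> [||y]; first exact: FM.
  - by apply: Fle => //; exact: FM.
  - by apply: le_trans (vF y); exact: Fle.
exists s; split=> // x; last exact: Es.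
by apply/eqP; rewrite eq_le sF Fs.
Qed.

(** Left continuity makes the sublevel set contain its supremum, so it is exactly a closed
    half-line. *)
Lemma inM_crossing u b : inM u -> (exists x, u x <= b) -> (exists x, b < u x) ->
  exists z, forall x, (u x <= b) = (x <= z).
Proof.
move=> uM [x0 hx0] [x1 hx1].
pose E := [set x | u x <= b].
have Eub : ubound E x1.
  move=> x; rewrite /E /= => hx; rewrite leNgt; apply/negP => /ltW.
  by move=> /(inM_ndecr uM); lra.
have hs : has_sup E by split; [exists x0|exists x1].
exists (sup E) => x; apply/idP/idP => [hx|xs].
  by apply: ub_le_sup => //; exists x1.
apply: inM_le_left => // y yx.
have d0 : 0 < sup E - y by lra.
have [z hz yz] := sup_adherent d0 hs; rewrite /E /= in hz.
by apply: le_trans hz; apply: (inM_ndecr uM); lra.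
Qed.

(** For a monotone function the limit at [-oo] is the infimum; this order form makes limits easy to
    compare. *)
Definition left_limit u l := (forall x, l <= u x) /\
  forall e, 0 < e -> exists x, u x < l + e.

Definition right_limit u l := (forall x, u x <= l) /\
  forall e, 0 < e -> exists x, l < u x + e.

Lemma left_limit_ex u : inM u -> exists2 l, left_limit u l & 0 <= l <= 1.
Proof.
move=> uM; have lb0 : lbound (range u) 0 by move=> _ [x _ <-]; exact: inM_ge0.
have hi : has_inf (range u) by split; [exists (u 0), 0|exists 0].
have ge x : inf (range u) <= u x by apply: ge_inf; [exists 0|exists x].
exists (inf (range u)).
  split=> // e e0; have [_ [x _ <-] hx] := inf_adherent e0 hi.
  by exists x.
rewrite lb_le_inf//=; last by exists (u 0), 0.
by apply: le_trans (ge 0) _; exact: inM_le1.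
Qed.

Lemma right_limit_ex u : inM u -> exists2 l, right_limit u l & 0 <= l <= 1.
Proof.
move=> uM; have ub1 : ubound (range u) 1 by move=> _ [x _ <-]; exact: inM_le1.
have hs : has_sup (range u) by split; [exists (u 0), 0|exists 1].
have ge x : u x <= sup (range u) by apply: ub_le_sup; [exists 1|exists x].
exists (sup (range u)).
  split=> // e e0; have [_ [x _ <-] hx] := sup_adherent e0 hs.
  by exists x; lra.
rewrite ge_sup//= ?andbT; last by exists (u 0), 0.
by apply: le_trans (ge 0); exact: inM_ge0.
Qed.

Lemma left_limit_le u v l m X : inM u -> left_limit u l -> left_limit v m ->
  (forall x, x <= X -> u x <= v x) -> inM v -> l <= m.
Proof.
move=> uM [lu _] [_ mv] uv vM; apply/ler_addgt0Pr => e /mv [x hx].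
have := lu (Num.min x X); have := uv (Num.min x X).
have mX : Num.min x X <= X by rewrite ge_min lexx orbT.
have mx : Num.min x X <= x by rewrite ge_min lexx.
by move=> /(_ mX); have := inM_ndecr vM mx; lra.
Qed.

Lemma right_limit_le u v l m X : inM u -> right_limit u l -> right_limit v m ->
  (forall x, X < x -> u x <= v x) -> inM v -> l <= m.
Proof.
move=> uM [_ lu] [mv _] uv vM; apply/ler_addgt0Pr => e /lu [x hx].
have := mv (Num.max x (X + 1)); have := uv (Num.max x (X + 1)).
have mX : X < Num.max x (X + 1) by rewrite lt_max; apply/orP; right; lra.
have mx : x <= Num.max x (X + 1) by rewrite le_max lexx.
by move=> /(_ mX); have := inM_ndecr uM mx; lra.
Qed.

Lemma lim_minf_left_limit u l : inM u -> left_limit u l <-> lim_minf u l.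
Proof.
move=> uM; split=> [[lu ul]|].
  apply/cvgrPdist_lt => e e0; have [x hx] := ul e e0.
  near=> y; have yx : y <= x by near: y; apply: nbhs_ninfty_le; exact: num_real.
  have := lu y; have := inM_ndecr uM yx => ? ?.
  by rewrite ltr_norml; lra.
move=> /cvgrPdist_lt ul.
have ev e : 0 < e -> exists x, forall y, y < x -> `|l - u y| < e.
  by move=> /ul [x [_ hx]]; exists x.
split=> [x|e e0].
  apply/ler_addgt0Pr => e /ev [x' hx'].
  pose y := Num.min x (x' - 1).
  have yx : y <= x by rewrite ge_min lexx.
  have /hx' : y < x' by rewrite gt_min; apply/orP; right; lra.
  by rewrite ltr_norml; have := inM_ndecr uM yx; lra.
have [x hx] := ev e e0.
by exists (x - 1); have := hx (x - 1); rewrite ltr_norml; lra.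
Unshelve. all: by end_near. Qed.

Lemma lim_pinf_right_limit u l : inM u -> right_limit u l <-> lim_pinf u l.
Proof.
move=> uM; split=> [[lu ul]|].
  apply/cvgrPdist_lt => e e0; have [x hx] := ul e e0.
  near=> y; have yx : x <= y by near: y; apply: nbhs_pinfty_ge; exact: num_real.
  have := lu y; have := inM_ndecr uM yx => ? ?.
  by rewrite ltr_norml; lra.
move=> /cvgrPdist_lt ul.
have ev e : 0 < e -> exists x, forall y, x < y -> `|l - u y| < e.
  by move=> /ul [x [_ hx]]; exists x.
split=> [x|e e0].
  apply/ler_addgt0Pr => e /ev [x' hx'].
  pose y := Num.max x (x' + 1).
  have yx : x <= y by rewrite le_max lexx.
  have /hx' : x' < y by rewrite lt_max; apply/orP; right; lra.
  by rewrite ltr_norml; have := inM_ndecr uM yx; lra.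
have [x hx] := ev e e0.
by exists (x + 1); have := hx (x + 1); rewrite ltr_norml; lra.
Unshelve. all: by end_near. Qed.

End MonotoneFunctions.

(** * Weak convergence along an ultrafilter *)

Section UltrafilterConvergence.
Set Implicit Arguments. Unset Strict Implicit.
Variable R : realType.
Variables (U : set_system nat) (UU : UltraFilter U) (ooU : \oo `<=` U).
Implicit Types (u v w : R -> R) (x y a b c e l m : R).
Implicit Types (uk vk wk : nat -> R -> R) (s t : nat -> R).

Lemma ultra_not (P : nat -> Prop) :
  ~ (\forall k \near U, P k) -> \forall k \near U, ~ P k.
Proof. by case: (in_ultra_setVsetC [set k | P k] UU). Qed.

Lemma near_all (P : nat -> Prop) : (forall k, P k) -> \forall k \near U, P k.
Proof. by move=> h; apply: filterE. Qed.

Lemma near_const (P : Prop) : (\forall k \near U, P) -> P.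
Proof. by move=> /filter_ex [_]. Qed.

Definition ucvg s c := forall e, 0 < e -> \forall k \near U, c - e < s k < c + e.

Lemma ucvg_bounded s a b : (\forall k \near U, a <= s k <= b) ->
  exists2 c, ucvg s c & a <= c <= b.
Proof.
move=> sab.
pose E := [set r : R | \forall k \near U, r <= s k].
have Ea : E a by apply: filterS sab => k /andP[].
have Eb : ubound E b.
  move=> r /filterI /(_ sab) /filter_ex [k [rk /andP[_]]].
  exact: le_trans.
have Es : has_sup E by split; [exists a|exists b].
exists (sup E); last by rewrite ub_le_sup ?ge_sup //; [exists a|exists b].
move=> e e0; have [c Ec ce] := sup_adherent e0 Es.
have : \forall k \near U, ~ (sup E + e <= s k).
  apply: ultra_not => h.
  have : sup E + e <= sup E by apply: ub_le_sup => //; exists b.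
  by lra.
apply: filterS2 Ec => k ck /negP; rewrite -ltNge => hk.
by apply/andP; split => //; lra.
Qed.

Lemma ucvg_cst c : ucvg (fun=> c) c.
Proof. by move=> e e0; apply: near_all => k; lra. Qed.

Lemma ucvg_dist s t c : (forall n : nat, `|t n - s n| <= n.+1%:R^-1) ->
  ucvg s c -> ucvg t c.
Proof.
move=> st sc e e0; have e20 : 0 < e / 2 by lra.
have := ooU (near_infty_natSinv_lt (PosNum e20)).
apply: filterS2 (sc _ e20) => k hk ke.
have {}ke : k.+1%:R^-1 < e / 2 by [].
have := st k; rewrite ler_norml; move: (k.+1%:R^-1) ke => i ke ?.
by lra.
Qed.

(* Convergence at every continuity point of [u]. *)
Definition wcvg uk u := forall x y e, x < y -> 0 < e ->
  \forall k \near U, uk k x < u y + e /\ u x < uk k y + e.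

Lemma wcvg_cst u : inM u -> wcvg (fun=> u) u.
Proof.
move=> uM x y e xy e0; apply: near_all => k.
by have := inM_ndecr uM (ltW xy); split; lra.
Qed.

(** The limit at [x] is the supremum of the eventual lower bounds of [uk k y] over [y < x]. The
    strict inequality is what makes it left continuous. *)
Lemma helly uk : (forall k, inM (uk k)) -> exists2 u, inM u & wcvg uk u.
Proof.
move=> ukM.
pose E x := [set r | exists2 y, y < x & \forall k \near U, r <= uk k y].
have E0 x : E x 0.
  by exists (x - 1); [lra|apply: near_all => k; exact: inM_ge0].
have E1 x : ubound (E x) 1.
  move=> r [y _ /filter_ex[k]] rk.
  by apply: le_trans rk _; exact: inM_le1.
have hE x : has_sup (E x) by split; [exists 0|exists 1].
have Esup x r : E x r -> r <= sup (E x).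
  by move=> ?; apply: ub_le_sup => //; exists 1.
pose u x := sup (E x).
have uM : inM u.
  apply/inMP; split=> [x y xy|x e e0|x].
  - apply: ge_sup => [|r [z zx zt]]; first by exists 0.
    by apply: Esup; exists z => //; lra.
  - have [r [y yx ty] ht] := sup_adherent e0 (hE x).
    exists ((x + y) / 2); first by lra.
    suff : r <= u ((x + y) / 2) by move: ht; rewrite -/(u x); lra.
    by apply: Esup; exists y => //; lra.
  - by rewrite Esup//=; apply: ge_sup => //; exists 0.
exists u => // x y e xy e0.
have h1 : \forall k \near U, ~ (u y + e <= uk k x).
  apply: ultra_not => h.
  have : u y + e <= u y by apply: Esup; exists x.
  by lra.
have [r [z zx tz] ht] := sup_adherent e0 (hE x).
apply: filterS2 h1 tz => k /negP; rewrite -ltNge => hk rk; split=> //.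
have zy : z <= y by lra.
by have := inM_ndecr (ukM k) zy; move: ht; rewrite -/(u x); lra.
Qed.

Lemma wcvg_transl uk u s c : (forall k, inM (uk k)) -> inM u -> wcvg uk u ->
  ucvg s c -> wcvg (fun k => transl (s k) (uk k)) (transl c u).
Proof.
rewrite /transl => ukM uM uku sc x y e xy e0.
(* The gap between [x] and [y] absorbs both errors [s k - c] and leaves a third for the weak
   convergence. *)
pose d := (y - x) / 3.
have d0 : 0 < d by rewrite /d; lra.
have xyd : x - c + d < y - c - d by rewrite /d; lra.
apply: filterS2 (sc _ d0) (uku _ _ _ xyd e0) => k sk [h1 h2].
have a1 : x - s k <= x - c + d by lra.
have a2 : y - c - d <= y - c by lra.
have a3 : x - c <= x - c + d by lra.
have a4 : y - c - d <= y - s k by lra.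
have := inM_ndecr (ukM k) a1; have := inM_ndecr uM a2.
have := inM_ndecr uM a3; have := inM_ndecr (ukM k) a4.
by split; lra.
Qed.

(** Left continuity recovers the value at [x] from any interval []p, x[], so a comparison valid only
    there is enough. This locality matters near the ends of the windows. *)
Lemma wcvg_le uk vk u v x p : wcvg uk u -> wcvg vk v -> inM u -> inM v ->
  p < x ->
  (forall y e, p < y < x -> 0 < e -> \forall k \near U, uk k y <= vk k y + e) ->
  u x <= v x.
Proof.
move=> uku vkv uM vM px uvk; apply: inM_le_left => // y yx.
pose y0 := Num.max p y.
have y0x : y0 < x by rewrite /y0 gt_max px.
have yy0 : y <= y0 by rewrite /y0 le_max lexx orbT.
have py0 : p <= y0 by rewrite /y0 le_max lexx.
apply: (le_trans (inM_ndecr uM yy0)); apply/ler_addgt0Pr => e e0.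
have e30 : 0 < e / 3 by lra.
have l1 : y0 < (y0 + x) / 2 by lra.
have l2 : (y0 + x) / 2 < x by lra.
have l3 : p < (y0 + x) / 2 < x by lra.
apply: near_const.
apply: filterS3 (uku _ _ _ l1 e30) (vkv _ _ _ l2 e30) (uvk _ _ l3 e30).
by move=> k [_ ?] [? _] ?; lra.
Qed.

Lemma wcvg_le_near uk vk u v x p : wcvg uk u -> wcvg vk v -> inM u -> inM v ->
  p < x ->
  (forall y, p < y < x -> \forall k \near U, uk k y <= vk k y) -> u x <= v x.
Proof.
move=> uku vkv uM vM px h; apply: (wcvg_le uku vkv uM vM px) => y e /h hy e0.
by apply: filterS hy => k; lra.
Qed.

(** A limit at infinity becomes a weak limit of translates, to which the weak continuity of the map
    applies. *)
Lemma wcvg_left_limit u l : inM u ->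
  wcvg (fun k => transl k%:R u) (fun=> l) <-> left_limit u l.
Proof.
rewrite /transl => uM; split=> [h|[lu ul] x y e xy e0].
  split=> [x|e e0].
    apply/ler_addgt0Pr => e e0; apply: near_const.
    apply: filterS (h (x - 1) x e _ e0); last by lra.
    move=> k [_ ]; have xk : x - k%:R <= x by have := ler0n R k; lra.
    by have := inM_ndecr uM xk; lra.
  have [k []] := filter_ex (h 0 1 e ltr01 e0).
  by exists (0 - k%:R).
have [z hz] := ul e e0.
have := ooU (nbhs_infty_gtr (x - z)).
apply: filterS => k /= xzk; split.
  have xz : x - k%:R <= z by lra.
  by have := inM_ndecr uM xz; lra.
by have := lu (y - k%:R); lra.
Qed.

Lemma wcvg_right_limit u l : inM u ->
  wcvg (fun k => transl (- k%:R) u) (fun=> l) <-> right_limit u l.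
Proof.
rewrite /transl => uM; split=> [h|[lu ul] x y e xy e0].
  split=> [x|e e0].
    apply/ler_addgt0Pr => e e0; apply: near_const.
    apply: filterS (h x (x + 1) e _ e0); last by lra.
    move=> k [+ _]; have xk : x <= x - - k%:R by have := ler0n R k; lra.
    by have := inM_ndecr uM xk; lra.
  have [k []] := filter_ex (h 0 1 e ltr01 e0).
  by exists (1 - - k%:R).
have [z hz] := ul e e0.
have := ooU (nbhs_infty_gtr (z - y)).
apply: filterS => k /= xzk; split.
  by have := lu (x - - k%:R); lra.
have xz : z <= y - - k%:R by lra.
by have := inM_ndecr uM xz; lra.
Qed.

End UltrafilterConvergence.

(** * Weak continuity of the map *)

Section WeakContinuity.
Set Implicit Arguments. Unset Strict Implicit.
Variable R : realType.
Implicit Types (u v w : R -> R) (x y a b c e l m : R).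
Implicit Types (uk vk wk : nat -> R -> R) (s t : nat -> R).

Lemma ae_itvoo (P : R -> Prop) a b :
  {ae (@lebesgue_measure R), forall x, P x} -> a < b ->
  exists2 x, a < x < b & P x.
Proof.
move=> aeP ab; apply: contrapT => nP.
have : (@lebesgue_measure R).-negligible `]a, b[%classic.
  apply: negligibleS aeP => x /=; rewrite in_itv /= => xab Px.
  by apply: nP; exists x.
move=> /(negligibleP (@lebesgue_measure R) (measurable_itv `]a, b[)).1 mu0.
have : @lebesgue_measure R `]a, b[%classic = 0%E by [].
rewrite lebesgue_measure_itv /= lte_fin ab => /eqP.
by rewrite -EFinB eqe; lra.
Qed.

Variables (U : set_system nat) (UU : UltraFilter U) (ooU : \oo `<=` U).

(** It is close to [u] on bounded sets for large [n], but has room elsewhere: it is constant left of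
    [- n%:R], lies [n.+1%:R^-1] above [u] where not capped, and its ramp reaches 1 by [n%:R + 1].
    Weakly close functions then fit below it on the whole line. *)
Definition upper_envelope u (n : nat) x : R :=
  Num.min 1 (Num.max (u x) (u (- n%:R)) + (n.+1%:R^-1 + Num.max 0 (x - n%:R))).

(** The mirror image: constant right of [n%:R], with a ramp down to 0 on the left. *)
Definition lower_envelope u (n : nat) x : R :=
  Num.max 0 (Num.min (u x) (u n%:R) - (n.+1%:R^-1 + Num.max 0 (- n%:R - x))).

Lemma inM_upper_envelope u n : inM u -> inM (upper_envelope u n).
Proof.
rewrite /upper_envelope => uM; have vM := inM_max uM (inM_cst (a := u (- n%:R)) _).
have /vM {}vM : 0 <= u (- n%:R) <= 1 by rewrite (inM_ge0 uM) (inM_le1 uM).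
have n0 : 0 < n.+1%:R^-1 :> R by rewrite invr_gt0 ltr0Sn.
move: (n.+1%:R^-1) n0 => i i0.
set v := (fun x => Num.max _ _) in vM.
apply/inMP; split=> [x y xy|x e e0|x]; rewrite -/(v x).
- rewrite -/(v y); have := inM_ndecr vM xy; rewrite !minEle !maxEle => ?.
  by do ![case: ifP]; lra.
- have e20 : 0 < e / 2 by lra.
  have [y yx vy] := inM_left vM x e20.
  pose z := Num.max y (x - e / 2).
  have zx : z < x by rewrite /z gt_max yx; lra.
  have yz : y <= z by rewrite /z le_max lexx.
  have ez : x - e / 2 <= z by rewrite /z le_max lexx orbT.
  exists z => //; have := inM_ndecr vM yz; rewrite -/(v z) !minEle !maxEle => ?.
  by do ![case: ifP]; lra.
- have := inM_ge0 vM x; rewrite !minEle !maxEle => ?.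
  by do ![case: ifP]; lra.
Qed.

Lemma inM_lower_envelope u n : inM u -> inM (lower_envelope u n).
Proof.
rewrite /lower_envelope => uM; have vM := inM_min uM (inM_cst (a := u n%:R) _).
have /vM {}vM : 0 <= u n%:R <= 1 by rewrite (inM_ge0 uM) (inM_le1 uM).
have n0 : 0 < n.+1%:R^-1 :> R by rewrite invr_gt0 ltr0Sn.
move: (n.+1%:R^-1) n0 => i i0.
set v := (fun x => Num.min _ _) in vM.
apply/inMP; split=> [x y xy|x e e0|x]; rewrite -/(v x).
- rewrite -/(v y); have := inM_ndecr vM xy; rewrite !maxEle => ?.
  by do ![case: ifP]; lra.
- have e20 : 0 < e / 2 by lra.
  have [y yx vy] := inM_left vM x e20.
  pose z := Num.max y (x - e / 2).
  have zx : z < x by rewrite /z gt_max yx; lra.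
  have yz : y <= z by rewrite /z le_max lexx.
  have ez : x - e / 2 <= z by rewrite /z le_max lexx orbT.
  exists z => //; have := inM_ndecr vM yz; rewrite -/(v z) !maxEle => ?.
  by do ![case: ifP]; lra.
- have := inM_le1 vM x; rewrite !maxEle => ?.
  by do ![case: ifP]; lra.
Qed.

Lemma upper_envelope_cvg u : inM u -> unif_cvg_bounded (upper_envelope u) u.
Proof.
move=> uM a b e e0; near=> n => x xab.
have n0 : 0 < n.+1%:R^-1 :> R by rewrite invr_gt0 ltr0Sn.
have ne : n.+1%:R^-1 < e by near: n; exact: (near_infty_natSinv_lt (PosNum e0)).
have bn : b < n%:R by near: n; exact: nbhs_infty_gtr.
have an : - a < n%:R by near: n; exact: nbhs_infty_gtr.
have nx : - n%:R <= x by lra.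
have := inM_ndecr uM nx; have := inM_le1 uM x.
rewrite /upper_envelope ltr_norml; move: (n.+1%:R^-1) n0 ne => i n0 ne.
by rewrite minEle !maxEle; do ![case: ifP]; lra.
Unshelve. all: by end_near. Qed.

Lemma lower_envelope_cvg u : inM u -> unif_cvg_bounded (lower_envelope u) u.
Proof.
move=> uM a b e e0; near=> n => x xab.
have n0 : 0 < n.+1%:R^-1 :> R by rewrite invr_gt0 ltr0Sn.
have ne : n.+1%:R^-1 < e by near: n; exact: (near_infty_natSinv_lt (PosNum e0)).
have bn : b < n%:R by near: n; exact: nbhs_infty_gtr.
have an : - a < n%:R by near: n; exact: nbhs_infty_gtr.
have nx : x <= n%:R by lra.
have := inM_ndecr uM nx; have := inM_ge0 uM x.
rewrite /lower_envelope ltr_norml; move: (n.+1%:R^-1) n0 ne => i n0 ne.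
by rewrite minEle !maxEle; do ![case: ifP]; lra.
Unshelve. all: by end_near. Qed.

(** Otherwise there are violating points for [U]-almost all [k]. They can be moved into a compact
    interval, hence converge along [U], and weak convergence near their limit contradicts the margin
    [n.+1%:R^-1]. *)
Lemma upper_envelope_ge uk u n d : (forall k, inM (uk k)) -> inM u ->
  wcvg U uk u -> 0 < d ->
  \forall k \near U, forall x, uk k x <= upper_envelope u n (x + d).
Proof.
move=> ukM uM uku d0; apply: contrapT => /(ultra_not UU) h.
pose B k x := upper_envelope u n (x + d) < uk k x /\ - n%:R - d <= x <= n%:R + 1.
have n0 : 0 < n.+1%:R^-1 :> R by rewrite invr_gt0 ltr0Sn.
have {}h : \forall k \near U, exists x, B k x.
  apply: filterS h => k /existsNP [x /negP]; rewrite -ltNge => hx.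
  (* Left of [- n%:R - d] the shifted envelope is constant while [uk k] increases, so a violation
     persists when moved right to that point. *)
  pose z := Num.max x (- n%:R - d); exists z.
  have xz : x <= z by rewrite /z le_max lexx.
  have nz : - n%:R - d <= z by rewrite /z le_max lexx orbT.
  have zE : upper_envelope u n (z + d) = upper_envelope u n (x + d).
    rewrite /z; case: (leP x (- n%:R - d)) => // xn.
    have xn' : x + d <= - n%:R by lra.
    have := ler0n R n => ?.
    rewrite /upper_envelope; congr Num.min; congr (_ + _).
      by rewrite subrK maxxx; apply/esym/max_r/(inM_ndecr uM).
    by congr (_ + _); rewrite !maxEle; do ![case: ifP]; lra.
  have ux := inM_ndecr (ukM k) xz.
  split; first by rewrite zE; lra.
  (* Beyond [n%:R + 1] the ramp has brought the envelope to 1, which excludes a violation. *)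
  rewrite nz leNgt; apply/negP => zn.
  move: hx; rewrite -zE /upper_envelope minEle.
  have := inM_le1 (ukM k) x; have := inM_ge0 uM (z + d); rewrite !maxEle.
  move: (n.+1%:R^-1) n0 => i n0.
  by do ![case: ifP]; lra.
have [xs hxs] : {xs : nat -> R & forall k, (exists x, B k x) -> B k (xs k)}.
  exists (fun k => xget 0 [set x | B k x]) => k [x Bx].
  by case: xgetP => [z -> //|/(_ x)].
have [c cx _] : exists2 c, ucvg U xs c & - n%:R - d <= c <= n%:R + 1.
  by apply: (ucvg_bounded UU); apply: filterS h => k /hxs [].
have d40 : 0 < d / 4 by lra.
(* Eventually [xs k] is left of the first point and [xs k + d] right of the second. *)
have cd : c + d / 4 < c + d / 2 by lra.
apply: (near_const UU).
apply: filterS3 h (cx _ d40) (uku _ _ _ cd n0) => k /hxs [Bx _] xc [kn _].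
have x1 : xs k <= c + d / 4 by lra.
have x2 : c + d / 2 <= xs k + d by lra.
have := inM_ndecr (ukM k) x1; have := inM_ndecr uM x2.
have := inM_le1 (ukM k) (xs k).
move: Bx kn; rewrite /upper_envelope minEle !maxEle.
move: (n.+1%:R^-1) n0 => i n0.
by do ![case: ifP]; lra.
Qed.

Lemma lower_envelope_le uk u n d : (forall k, inM (uk k)) -> inM u ->
  wcvg U uk u -> 0 < d ->
  \forall k \near U, forall x, lower_envelope u n (x - d) <= uk k x.
Proof.
move=> ukM uM uku d0; apply: contrapT => /(ultra_not UU) h.
pose B k x := uk k x < lower_envelope u n (x - d) /\ - n%:R - 1 <= x <= n%:R + d.
have n0 : 0 < n.+1%:R^-1 :> R by rewrite invr_gt0 ltr0Sn.
have {}h : \forall k \near U, exists x, B k x.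
  apply: filterS h => k /existsNP [x /negP]; rewrite -ltNge => hx.
  pose z := Num.min x (n%:R + d); exists z.
  have xz : z <= x by rewrite /z ge_min lexx.
  have nz : z <= n%:R + d by rewrite /z ge_min lexx orbT.
  have zE : lower_envelope u n (z - d) = lower_envelope u n (x - d).
    rewrite /z; case: (leP x (n%:R + d)) => // xn.
    have xn' : n%:R <= x - d by lra.
    have := ler0n R n => ?.
    rewrite /lower_envelope; congr Num.max; congr (_ - _).
      by rewrite addrK minxx; apply/esym/min_r/(inM_ndecr uM).
    by congr (_ + _); rewrite !maxEle; do ![case: ifP]; lra.
  have ux := inM_ndecr (ukM k) xz.
  split; first by rewrite zE; lra.
  rewrite nz andbT leNgt; apply/negP => zn.
  move: hx; rewrite -zE /lower_envelope minEle.
  have := inM_ge0 (ukM k) x; have := inM_le1 uM (z - d); rewrite !maxEle.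
  move: (n.+1%:R^-1) n0 => i n0.
  by do ![case: ifP]; lra.
have [xs hxs] : {xs : nat -> R & forall k, (exists x, B k x) -> B k (xs k)}.
  exists (fun k => xget 0 [set x | B k x]) => k [x Bx].
  by case: xgetP => [z -> //|/(_ x)].
have [c cx _] : exists2 c, ucvg U xs c & - n%:R - 1 <= c <= n%:R + d.
  by apply: (ucvg_bounded UU); apply: filterS h => k /hxs [].
have d40 : 0 < d / 4 by lra.
have cd : c - d / 2 < c - d / 4 by lra.
apply: (near_const UU).
apply: filterS3 h (cx _ d40) (uku _ _ _ cd n0) => k /hxs [Bx _] xc [_ kn].
have x1 : c - d / 4 <= xs k by lra.
have x2 : xs k - d <= c - d / 2 by lra.
have := inM_ndecr (ukM k) x1; have := inM_ndecr uM x2.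
have := inM_ge0 (ukM k) (xs k).
move: Bx kn; rewrite /lower_envelope minEle !maxEle.
move: (n.+1%:R^-1) n0 => i n0.
by do ![case: ifP]; lra.
Qed.

Variable Q : (R -> R) -> R -> R.
Hypothesis QM : forall u, inM u -> inM (Q u).
Hypothesis Q_cvg : forall uk u, (forall k, inM (uk k)) -> inM u ->
  unif_cvg_bounded uk u ->
  {ae (@lebesgue_measure R), forall x, Q (uk k) x @[k --> \oo] --> Q u x}.
Hypothesis Q_le : forall u v, inM u -> inM v -> (forall x, u x <= v x) ->
  forall x, Q u x <= Q v x.
Hypothesis Q_transl : forall x0 u, inM u -> transl x0 (Q u) = Q (transl x0 u).

(* Up to an arbitrarily small translation, [uk k] is squeezed between envelopes
   of [u] which converge to [u] locally uniformly. *)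
Lemma wcvg_preserved uk u : (forall k, inM (uk k)) -> inM u -> wcvg U uk u ->
  wcvg U (fun k => Q (uk k)) (Q u).
Proof.
move=> ukM uM uku x y e xy e0.
pose d := (y - x) / 2; have d0 : 0 < d by rewrite /d; lra.
have xdy : x + d < y by rewrite /d; lra.
have xyd : x < y - d by rewrite /d; lra.
have upM n := inM_upper_envelope n uM.
have loM n := inM_lower_envelope n uM.
(* Convergence is known only almost everywhere, so a convergence point is picked in []x + d, y[]; it
   leaves room for the shift by [d]. The point [q] plays the same role for the lower envelopes. *)
have [p /andP[xp py] /cvgrPdist_lt /(_ e e0) pn] :=
  ae_itvoo (Q_cvg upM uM (upper_envelope_cvg uM)) xdy.
have [q /andP[xq qy] /cvgrPdist_lt /(_ e e0) qn] :=
  ae_itvoo (Q_cvg loM uM (lower_envelope_cvg uM)) xyd.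
have [n /= pn'] := @filter_ex _ \oo _ _ pn.
have [m /= qm'] := @filter_ex _ \oo _ _ qn.
apply: filterS2 (upper_envelope_ge n ukM uM uku d0)
  (lower_envelope_le m ukM uM uku d0) => k hn hm; split.
- have tM : inM (transl (- d) (upper_envelope u n)) by exact: inM_transl.
  have := Q_le (ukM k) tM _ x; rewrite -Q_transl // /transl opprK => h.
  have {}h := h hn.
  have := inM_ndecr (QM (upM n)) (ltW xp); have := inM_ndecr (QM uM) (ltW py).
  by move: pn'; rewrite ltr_norml; lra.
- have tM : inM (transl d (lower_envelope u m)) by exact: inM_transl.
  have := Q_le tM (ukM k) _ y; rewrite -Q_transl // /transl => h.
  have {}h := h hm.
  have := inM_ndecr (QM (loM m)) (ltW qy); have := inM_ndecr (QM uM) (ltW xq).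
  by move: qm'; rewrite ltr_norml; lra.
Qed.

End WeakContinuity.

(** * Waves *)

Section BistableWaves.
Set Implicit Arguments. Unset Strict Implicit.
Variable R : realType.
Implicit Types (u v w : R -> R) (x y a b c e l m : R).
Implicit Types (uk vk wk : nat -> R -> R) (s : nat -> R).
Variables (U : set_system nat) (UU : UltraFilter U) (ooU : \oo `<=` U).
Variables (Q : (R -> R) -> R -> R) (alpha : R).
Hypothesis QM : forall u, inM u -> inM (Q u).
Hypothesis Q_le : forall u v, inM u -> inM v -> (forall x, u x <= v x) ->
  forall x, Q u x <= Q v x.
Hypothesis Q_transl : forall x0 u, inM u -> transl x0 (Q u) = Q (transl x0 u).
Hypothesis Q_wcvg : forall uk u, (forall k, inM (uk k)) -> inM u ->
  wcvg U uk u -> wcvg U (fun k => Q (uk k)) (Q u).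
Hypothesis alpha01 : 0 < alpha < 1.
Hypothesis Q_alpha : Q (fun=> alpha) = (fun=> alpha).
Hypothesis Q_below : forall gamma : R, 0 < gamma < alpha ->
  forall x, Q (fun=> gamma) x < gamma.
Hypothesis Q_above : forall gamma : R, alpha < gamma < 1 ->
  forall x, gamma < Q (fun=> gamma) x.

(** Waves of speed [c] are the fixed points of this order preserving map, which commutes with
    translations. *)
Definition Qs c u : R -> R := transl c (Q u).

Lemma inM_Qs c u : inM u -> inM (Qs c u).
Proof. by move=> uM; apply: inM_transl; exact: QM. Qed.

Lemma Qs_le c u v x : inM u -> inM v -> (forall y, u y <= v y) ->
  Qs c u x <= Qs c v x.
Proof. by move=> uM vM uv; exact: Q_le. Qed.

Lemma Qs_transl c a u : inM u -> Qs c (transl a u) = transl a (Qs c u).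
Proof.
move=> uM; rewrite /Qs -Q_transl //; apply/funext => x.
by rewrite /transl addrAC.
Qed.

Lemma Qs_wcvg s c uk u : (forall k, inM (uk k)) -> inM u -> wcvg U uk u ->
  ucvg U s c -> wcvg U (fun k => Qs (s k) (uk k)) (Qs c u).
Proof.
move=> ukM uM uku sc; apply: wcvg_transl => // [k||]; first exact: QM.
  exact: QM.
exact: Q_wcvg.
Qed.

(** * Limits at infinity of sub- and supersolutions *)

Lemma Q_cst l x : 0 <= l <= 1 -> Q (fun=> l) x = Q (fun=> l) 0.
Proof.
move=> l01; have h : transl (- x) (Q (fun=> l)) = Q (fun=> l) :=
  Q_transl (- x) (inM_cst l01).
by move: (congr1 (@^~ 0) h); rewrite /transl opprK add0r.
Qed.

(** The translates of [u] converge weakly to the constant [l], and [Qs c] commutes with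
    translations. *)
Lemma Qs_left_limit c u l : inM u -> 0 <= l <= 1 -> left_limit u l ->
  left_limit (Qs c u) (Q (fun=> l) 0).
Proof.
move=> uM l01 ul; apply/(wcvg_left_limit UU ooU _ (inM_Qs c uM)).
have /(Qs_wcvg (s := fun=> c) (c := c)) : wcvg U (fun k => transl k%:R u) (fun=> l).
  exact/wcvg_left_limit.
move=> /(_ (fun k => inM_transl _ uM) (inM_cst l01)) h.
have {}h := h (ucvg_cst UU c).
rewrite [X in wcvg _ _ X](_ : _ = Qs c (fun=> l)).
  by rewrite (_ : (fun k => _) = (fun k => Qs c (transl k%:R u))) //;
    apply/funext => k; rewrite Qs_transl.
by apply/funext => x; rewrite /Qs /transl Q_cst.
Qed.

Lemma Qs_right_limit c u l : inM u -> 0 <= l <= 1 -> right_limit u l ->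
  right_limit (Qs c u) (Q (fun=> l) 0).
Proof.
move=> uM l01 ul; apply/(wcvg_right_limit UU ooU _ (inM_Qs c uM)).
have /(Qs_wcvg (s := fun=> c) (c := c)) : wcvg U (fun k => transl (- k%:R) u) (fun=> l).
  exact/wcvg_right_limit.
move=> /(_ (fun k => inM_transl _ uM) (inM_cst l01)) h.
have {}h := h (ucvg_cst UU c).
rewrite [X in wcvg _ _ X](_ : _ = Qs c (fun=> l)).
  by rewrite (_ : (fun k => _) = (fun k => Qs c (transl (- k%:R) u))) //;
    apply/funext => k; rewrite Qs_transl.
by apply/funext => x; rewrite /Qs /transl Q_cst.
Qed.

(** At either end, a subsolution passes to [l <= Q l], impossible for [0 < l < alpha], and a
    supersolution to [Q l <= l], impossible for [alpha < l < 1]. In this lemma and the next three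
    the inequality is used only near the end concerned. *)
Lemma left_limit_sub c u l X : inM u -> 0 <= l <= 1 -> left_limit u l ->
  (forall x, x <= X -> u x <= Qs c u x) -> 0 < l -> alpha <= l.
Proof.
move=> uM l01 ul h l0; rewrite leNgt; apply/negP => la.
have := left_limit_le uM ul (Qs_left_limit c uM l01 ul) h (inM_Qs c uM).
by have := Q_below (gamma := l) _ 0; move: (Q _ 0) => q; lra.
Qed.

Lemma left_limit_super c u l X : inM u -> 0 <= l <= 1 -> left_limit u l ->
  (forall x, x <= X -> Qs c u x <= u x) -> l < 1 -> l <= alpha.
Proof.
move=> uM l01 ul h l0; rewrite leNgt; apply/negP => la.
have := left_limit_le (inM_Qs c uM) (Qs_left_limit c uM l01 ul) ul h uM.
by have := Q_above (gamma := l) _ 0; move: (Q _ 0) => q; lra.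
Qed.

Lemma right_limit_sub c u l X : inM u -> 0 <= l <= 1 -> right_limit u l ->
  (forall x, X < x -> u x <= Qs c u x) -> 0 < l -> alpha <= l.
Proof.
move=> uM l01 ul h l0; rewrite leNgt; apply/negP => la.
have := right_limit_le uM ul (Qs_right_limit c uM l01 ul) h (inM_Qs c uM).
by have := Q_below (gamma := l) _ 0; move: (Q _ 0) => q; lra.
Qed.

Lemma right_limit_super c u l X : inM u -> 0 <= l <= 1 -> right_limit u l ->
  (forall x, X < x -> Qs c u x <= u x) -> l < 1 -> l <= alpha.
Proof.
move=> uM l01 ul h l0; rewrite leNgt; apply/negP => la.
have := right_limit_le (inM_Qs c uM) (Qs_right_limit c uM l01 ul) ul h uM.
by have := Q_above (gamma := l) _ 0; move: (Q _ 0) => q; lra.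
Qed.

(** * Upgrading one-sided solutions to waves between [alpha] and 0 or 1 *)

Definition wave c l m := exists phi, [/\ inM phi, forall x, Qs c phi x = phi x,
  left_limit phi l & right_limit phi m].

(* The waves are limits of fixed points of [max (v k) (Qs c u)], where [v k]
   decreases to [alpha]: such a fixed point must tend to 1 at +oo while staying
   below [psi], and the constraint [v k] disappears in the limit. *)
Lemma wave_above c psi x0 x1 : inM psi -> (forall x, Qs c psi x <= psi x) ->
  (forall x, alpha <= psi x) -> alpha < psi x0 -> psi x1 < 1 ->
  wave c alpha 1.
Proof.
move=> psiM Ppsi apsi x0a x11; have a01 := alpha01.
pose i (k : nat) : R := k.+1%:R^-1.
have i0 k : 0 < i k by rewrite /i invr_gt0 ltr0Sn.
have aM : inM (fun=> alpha : R) by apply: inM_cst; lra.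
pose v k x := Num.min (psi x) (Num.min 1 (alpha + i k)).
have vM k : inM (v k).
  by apply: inM_min => //; apply: inM_cst; have := i0 k; rewrite minEle; case: ifP; lra.
have va k x : alpha <= v k x <= alpha + i k.
  by have := i0 k; have := apsi x; rewrite /v !minEle; do ![case: ifP]; lra.
have vpsi k x : v k x <= psi x by rewrite /v ge_min lexx.
have /choice[u uP] k : exists u, [/\ inM u,
    forall x, Num.max (v k x) (Qs c u x) = u x, forall x, v k x <= u x &
    forall x, u x <= psi x].
  apply: (@fixpoint_between _ (fun w x => Num.max (v k x) (Qs c w x))) => //.
  - by move=> w wM; apply: inM_max => //; exact: inM_Qs.
  - move=> w w' wM w'M ww' x; rewrite ge_max !le_max lexx/=.
    by rewrite Qs_le ?orbT.
  - by move=> x; rewrite le_max lexx.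
  - by move=> x; rewrite ge_max vpsi Ppsi.
have uM k : inM (u k) by case: (uP k).
have Pu k x : Qs c (u k) x <= u k x by case: (uP k) => _ <- *; rewrite le_max lexx orbT.
have vu k x : v k x <= u k x by case: (uP k).
have upsi k x : u k x <= psi x by case: (uP k).
have au k x : alpha <= u k x by have := vu k x; have := va k x; lra.
have aP k x : alpha <= Qs c (u k) x.
  have := Qs_le c x aM (uM k) (au k).
  by rewrite {1}/Qs Q_alpha.
(* Since [Qs c (u k)] is at least [alpha], the constraint [v k] can exceed it by at most [i k],
   which tends to 0. *)
have uPi k x : u k x <= Qs c (u k) x + i k.
  have [_ <- _ _] := uP k; have := aP k x; have := va k x; have := i0 k.
  by rewrite maxEle; case: ifP; lra.
(* A level in []alpha, 1[] not below [psi x1]: each [u k <= psi] is then at most [b] at [x1], and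
   exceeds [b] far to the right. *)
pose b := Num.max ((1 + alpha) / 2) ((1 + psi x1) / 2).
have b1 : alpha < b < 1 by rewrite /b maxEle; case: ifP; lra.
have psib : psi x1 <= b by rewrite /b maxEle; case: ifP; lra.
have /choice[z zP] k : exists z, forall x, (u k x <= b) = (x <= z).
  apply: inM_crossing => //; first by exists x1; exact: le_trans psib.
  have [l ul l01] := right_limit_ex (uM k).
  have al : alpha < l.
    have := vu k x0; have := ul.1 x0; have := i0 k.
    by rewrite /v !minEle; do ![case: ifP]; lra.
  have l1 : 1 <= l.
    rewrite leNgt; apply/negP => /(right_limit_super (X := 0) (uM k) l01 ul (fun x _ => Pu k x)).
    by lra.
  have [|x hx] := ul.2 (1 - b); first by lra.
  by exists x; lra.
(* Recentring puts the crossing of [b] at 0, so that the limit cannot degenerate to the constant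
   [alpha] or 1. *)
pose w k := transl (- z k) (u k).
have wM k : inM (w k) by exact: inM_transl.
have wE k x : w k x = u k (x + z k) by rewrite /w /transl opprK.
have PwE k x : Qs c (w k) x = Qs c (u k) (x + z k) by rewrite /w Qs_transl // /transl opprK.
have [phi phiM wphi] := helly UU wM.
have Pwphi := Qs_wcvg wM phiM wphi (ucvg_cst UU c).
have PphiM := inM_Qs c phiM.
have Pphi x : Qs c phi x = phi x.
  apply/eqP; rewrite eq_le; apply/andP; split.
    apply: (wcvg_le_near UU Pwphi wphi PphiM phiM (p := x - 1)); first by lra.
    by move=> y _; apply: near_all => k; rewrite PwE wE.
  apply: (wcvg_le UU wphi Pwphi phiM PphiM (p := x - 1)); first by lra.
  move=> y e _ e0; have := ooU (near_infty_natSinv_lt (PosNum e0)).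
  apply: filterS => k ke; have {}ke : i k < e by [].
  by have := uPi k (y + z k); rewrite PwE wE; lra.
have aphi x : alpha <= phi x.
  apply: (wcvg_le_near UU (wcvg_cst UU aM) wphi aM phiM (p := x - 1)); first by lra.
  by move=> y _; apply: near_all => k; rewrite wE.
have bM : inM (fun=> b : R) by apply: inM_cst; lra.
have phib : phi 0 <= b.
  apply: (wcvg_le_near UU wphi (wcvg_cst UU bM) phiM bM (p := -1)); first by lra.
  by move=> y y0; apply: near_all => k; rewrite wE zP; lra.
have bphi : b <= phi 1.
  apply: (wcvg_le_near UU (wcvg_cst UU bM) wphi bM phiM (p := 0)); first by lra.
  move=> y y0; apply: near_all => k; rewrite wE; apply: ltW.
  by rewrite ltNge zP; lra.
exists phi; split => //.
- have [l phil l01] := left_limit_ex phiM.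
  rewrite (_ : alpha = l) //; apply/eqP; rewrite eq_le.
  have lb := phil.1 0.
  rewrite (left_limit_super (X := 0) (c := c) phiM l01 phil) ?andbT; last 2 first.
  + by move=> x _; rewrite Pphi.
  + by lra.
  apply/ler_addgt0Pr => e /phil.2 [x hx]; have := aphi x; lra.
- have [l phil l01] := right_limit_ex phiM.
  rewrite (_ : 1 = l) //; apply/eqP; rewrite eq_le; apply/andP; split; last by lra.
  rewrite leNgt; apply/negP.
  move=> /(right_limit_super (X := 0) (c := c) phiM l01 phil) h.
  have := phil.1 1; have : l <= alpha by apply: h => x _; rewrite Pphi.
  by lra.
Qed.

(** Mirror image of [wave_above]: fixed points of [min (v k) (Qs c u)], with [v k] increasing to
    [alpha], stay above [psi] and must tend to 0 at [-oo]. *)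
Lemma wave_below c psi x0 x1 : inM psi -> (forall x, psi x <= Qs c psi x) ->
  (forall x, psi x <= alpha) -> psi x0 < alpha -> 0 < psi x1 ->
  wave c 0 alpha.
Proof.
move=> psiM psiP psia x0a x11; have a01 := alpha01.
pose i (k : nat) : R := k.+1%:R^-1.
have i0 k : 0 < i k by rewrite /i invr_gt0 ltr0Sn.
have aM : inM (fun=> alpha : R) by apply: inM_cst; lra.
pose v k x := Num.max (psi x) (Num.max 0 (alpha - i k)).
have vM k : inM (v k).
  by apply: inM_max => //; apply: inM_cst; have := i0 k; rewrite maxEle; case: ifP; lra.
have va k x : alpha - i k <= v k x <= alpha.
  by have := i0 k; have := psia x; rewrite /v !maxEle; do ![case: ifP]; lra.
have psiv k x : psi x <= v k x by rewrite /v le_max lexx.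
have /choice[u uP] k : exists u, [/\ inM u,
    forall x, Num.min (v k x) (Qs c u x) = u x, forall x, psi x <= u x &
    forall x, u x <= v k x].
  apply: (@fixpoint_between _ (fun w x => Num.min (v k x) (Qs c w x))) => //.
  - by move=> w wM; apply: inM_min => //; exact: inM_Qs.
  - move=> w w' wM w'M ww' x; rewrite le_min !ge_min lexx/=.
    by rewrite Qs_le ?orbT.
  - by move=> x; rewrite le_min psiv psiP.
  - by move=> x; rewrite ge_min lexx.
have uM k : inM (u k) by case: (uP k).
have uPle k x : u k x <= Qs c (u k) x by case: (uP k) => _ <- *; rewrite ge_min lexx orbT.
have uv k x : u k x <= v k x by case: (uP k).
have psiu k x : psi x <= u k x by case: (uP k).
have ua k x : u k x <= alpha by have := uv k x; have := va k x; lra.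
have Pa k x : Qs c (u k) x <= alpha.
  have := Qs_le c x (uM k) aM (ua k).
  by rewrite {2}/Qs Q_alpha.
have Pui k x : Qs c (u k) x <= u k x + i k.
  have [_ <- _ _] := uP k; have := Pa k x; have := va k x; have := i0 k.
  by rewrite minEle; case: ifP; lra.
pose b := Num.min (alpha / 2) (psi x1 / 2).
have b1 : 0 < b < alpha by rewrite /b minEle; case: ifP; lra.
have psib : b < psi x1 by rewrite /b minEle; case: ifP; lra.
have /choice[z zP] k : exists z, forall x, (u k x <= b) = (x <= z).
  apply: inM_crossing => //; last by exists x1; exact: lt_le_trans psib _.
  have [l ul l01] := left_limit_ex (uM k).
  have la : l < alpha.
    have := uv k x0; have := ul.1 x0; have := i0 k.
    by rewrite /v !maxEle; do ![case: ifP]; lra.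
  have l0 : l <= 0.
    rewrite leNgt; apply/negP => /(left_limit_sub (X := 0) (uM k) l01 ul (fun x _ => uPle k x)).
    by lra.
  have [|x hx] := ul.2 b; first by lra.
  by exists x; lra.
pose w k := transl (- z k) (u k).
have wM k : inM (w k) by exact: inM_transl.
have wE k x : w k x = u k (x + z k) by rewrite /w /transl opprK.
have PwE k x : Qs c (w k) x = Qs c (u k) (x + z k) by rewrite /w Qs_transl // /transl opprK.
have [phi phiM wphi] := helly UU wM.
have Pwphi := Qs_wcvg wM phiM wphi (ucvg_cst UU c).
have PphiM := inM_Qs c phiM.
have Pphi x : Qs c phi x = phi x.
  apply/eqP; rewrite eq_le; apply/andP; split; last first.
    apply: (wcvg_le_near UU wphi Pwphi phiM PphiM (p := x - 1)); first by lra.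
    by move=> y _; apply: near_all => k; rewrite PwE wE.
  apply: (wcvg_le UU Pwphi wphi PphiM phiM (p := x - 1)); first by lra.
  move=> y e _ e0; have := ooU (near_infty_natSinv_lt (PosNum e0)).
  apply: filterS => k ke; have {}ke : i k < e by [].
  by have := Pui k (y + z k); rewrite PwE wE; lra.
have phia x : phi x <= alpha.
  apply: (wcvg_le_near UU wphi (wcvg_cst UU aM) phiM aM (p := x - 1)); first by lra.
  by move=> y _; apply: near_all => k; rewrite wE.
have bM : inM (fun=> b : R) by apply: inM_cst; lra.
have phib : phi 0 <= b.
  apply: (wcvg_le_near UU wphi (wcvg_cst UU bM) phiM bM (p := -1)); first by lra.
  by move=> y y0; apply: near_all => k; rewrite wE zP; lra.
have bphi : b <= phi 1.
  apply: (wcvg_le_near UU (wcvg_cst UU bM) wphi bM phiM (p := 0)); first by lra.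
  move=> y y0; apply: near_all => k; rewrite wE; apply: ltW.
  by rewrite ltNge zP; lra.
exists phi; split => //.
- have [l phil l01] := left_limit_ex phiM.
  rewrite (_ : 0 = l) //; apply/eqP; rewrite eq_le; apply/andP; split; first by lra.
  rewrite leNgt; apply/negP.
  move=> /(left_limit_sub (X := 0) (c := c) phiM l01 phil) h.
  have := phil.1 0; have : alpha <= l by apply: h => x _; rewrite Pphi.
  by lra.
- have [l phil l01] := right_limit_ex phiM.
  rewrite (_ : alpha = l) //; apply/eqP; rewrite eq_le.
  have lb := phil.1 1.
  rewrite (right_limit_sub (X := 0) (c := c) phiM l01 phil) ?andTb; last 2 first.
  + by move=> x _; rewrite Pphi.
  + by lra.
  apply/ler_addgt0Pr => e /phil.2 [x hx]; have := phia x; lra.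
Qed.

(** * Solutions on a bounded window and their comparison *)

(* Satisfied by the fixed points of [min (step (- n)) (max (step n) (Qs c u))]. *)
Definition truncated c (n : nat) u := [/\ inM u, forall x, x <= - n%:R -> u x = 0,
  forall x, n%:R < x -> u x = 1, forall x, x <= n%:R -> u x <= Qs c u x &
  forall x, - n%:R < x -> Qs c u x <= u x].

Lemma truncated_ex c n : exists u, truncated c n u.
Proof.
pose F w x := Num.min (step (- n%:R) x) (Num.max (step n%:R x) (Qs c w x)).
have M0 : inM (fun=> 0 : R) by apply: inM_cst; lra.
have M1 : inM (fun=> 1 : R) by apply: inM_cst; lra.
have FM w : inM w -> inM (F w).
  move=> wM; apply: inM_min; first exact: inM_step.
  by apply: inM_max; [exact: inM_step|exact: inM_Qs].
have [||||u [uM uF _ _]] := @fixpoint_between _ F (fun=> 0) (fun=> 1) FM _ M0 M1.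
- move=> w w' wM w'M ww' x; have := Qs_le c x wM w'M ww'.
  by rewrite /F !minEle !maxEle; do ![case: ifP]; lra.
- by move=> _; lra.
- by move=> x; exact: inM_ge0 (FM _ M0) x.
- by move=> x; exact: inM_le1 (FM _ M1) x.
have n0 : 0 <= n%:R :> R by exact: ler0n.
exists u; split=> // x hx; have := inM_ge0 (inM_Qs c uM) x;
  have := inM_le1 (inM_Qs c uM) x; rewrite -[u x]uF /F /step.
- by rewrite hx minEle maxEle; do ![case: ifP]; lra.
- by rewrite [x <= n%:R]leNgt hx minEle maxEle; do ![case: ifP]; lra.
- by rewrite hx minEle maxEle; do ![case: ifP]; lra.
- by rewrite [x <= - n%:R]leNgt hx minEle maxEle; do ![case: ifP]; lra.
Qed.

(* Sliding: the subsolution, first placed at the right end of the window, can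
   be moved left in steps of length [cl - c] until it reaches the left end. *)
Lemma truncated_ge c n u cl psi : truncated c n u -> c < cl -> inM psi ->
  psi 0 = 0 -> (forall x, psi x <= Qs cl psi x) ->
  forall x, psi (x + n%:R) <= u x.
Proof.
move=> [uM u0 u1 _ Pu] ccl psiM psi0 psiP.
have d0 : 0 < cl - c by lra.
have n0 : 0 <= n%:R :> R by exact: ler0n.
have psineg x : x <= 0 -> psi x <= 0 by move=> /(inM_ndecr psiM); rewrite psi0.
have slide (j : nat) a : - n%:R <= a -> n%:R - j%:R * (cl - c) <= a ->
    forall x, psi (x - a) <= u x.
  elim: j a => [|j IH] a na ja x.
    have [xn|/u1 ->] := leP x n%:R; last exact: inM_le1.
    by apply: le_trans (psineg _ _) (inM_ge0 uM x); lra.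
  have [xn|xn] := leP x (- n%:R).
    by apply: le_trans (psineg _ _) (inM_ge0 uM x); lra.
  (* [Qs cl psi] translated by [a] equals [Qs c] of [psi] translated by [a + (cl - c)], and that
     translate is below [u] by induction. *)
  apply: le_trans (Pu _ xn); apply: le_trans (psiP _) _.
  have aM : inM (transl (a + (cl - c)) psi) by exact: inM_transl.
  have /(Qs_le c x aM uM) : forall y, transl (a + (cl - c)) psi y <= u y.
    by apply: IH; [lra|move: ja; rewrite -natr1 mulrDl mul1r; lra].
  by rewrite Qs_transl // /Qs /transl (_ : x - a - cl = x - (a + (cl - c)) - c) //; ring.
move=> x; have [j hj] : exists j : nat, n%:R - j%:R * (cl - c) <= - n%:R.
  have [j jP] := filter_ex (nbhs_infty_gtr (2 * n%:R / (cl - c))).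
  exists j; have : 2 * n%:R < j%:R * (cl - c) by rewrite -ltr_pdivrMr.
  by lra.
by have := slide j _ (lexx _) hj x; rewrite opprK.
Qed.

(** Sliding in the other direction: the supersolution starts at the left end and moves right in
    steps of length [c - cu]. *)
Lemma truncated_le c n u cu psi : truncated c n u -> cu < c -> inM psi ->
  psi 0 = 1 -> (forall x, Qs cu psi x <= psi x) ->
  forall x, u x <= psi (x - n%:R).
Proof.
move=> [uM u0 u1 uP _] cuc psiM psi0 psiP.
have d0 : 0 < c - cu by lra.
have n0 : 0 <= n%:R :> R by exact: ler0n.
have psipos x : 0 <= x -> 1 <= psi x by move=> /(inM_ndecr psiM); rewrite psi0.
have slide (j : nat) a : a <= n%:R -> a <= j%:R * (c - cu) - n%:R ->
    forall x, u x <= psi (x - a).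
  elim: j a => [|j IH] a na ja x.
    have [/u0 ->|xn] := leP x (- n%:R); first exact: inM_ge0.
    by apply: le_trans (inM_le1 uM x) (psipos _ _); lra.
  have [xn|xn] := leP x n%:R; last first.
    by apply: le_trans (inM_le1 uM x) (psipos _ _); lra.
  apply: le_trans (uP _ xn) _; apply: le_trans (psiP _).
  have aM : inM (transl (a - (c - cu)) psi) by exact: inM_transl.
  have /(Qs_le c x uM aM) : forall y, u y <= transl (a - (c - cu)) psi y.
    by apply: IH; [lra|move: ja; rewrite -natr1 mulrDl mul1r; lra].
  by rewrite Qs_transl // /Qs /transl (_ : x - a - cu = x - (a - (c - cu)) - c) //; ring.
move=> x; have [j hj] : exists j : nat, n%:R <= j%:R * (c - cu) - n%:R.
  have [j jP] := filter_ex (nbhs_infty_gtr (2 * n%:R / (c - cu))).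
  exists j; have : 2 * n%:R < j%:R * (c - cu) by rewrite -ltr_pdivrMr.
  by lra.
exact: slide hj x.
Qed.

Hypothesis no_stacked_waves : forall c, wave c 0 alpha -> wave c alpha 1 -> False.

(** * Limits of window solutions as the window grows *)

Section TruncatedFamily.
Variables (b b' c : R) (s : nat -> R) (nk : nat -> nat) (uk : nat -> R -> R).
Variables (z y : nat -> R).
Hypothesis bb' : 0 < b < alpha /\ alpha < b' < 1.
Hypothesis sc : ucvg U s c.
Hypothesis nkoo : forall A : R, \forall k \near U, A < (nk k)%:R.
Hypothesis ukT : forall k, truncated (s k) (nk k) (uk k).
Hypothesis zP : forall k x, (uk k x <= b) = (x <= z k).
Hypothesis yP : forall k x, (uk k x <= b') = (x <= y k).

Let ukM k : inM (uk k). Proof. by case: (ukT k). Qed.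

Let levels k : - (nk k)%:R <= z k <= y k /\ y k <= (nk k)%:R.
Proof.
have [h1 h2] := bb'; have [_ u0 u1 _ _] := ukT k.
have hz : - (nk k)%:R <= z k by rewrite -zP u0 //; lra.
have hzy : z k <= y k by rewrite -yP; have := zP k (z k); rewrite lexx; lra.
split; first by rewrite hz.
rewrite leNgt; apply/negP => /u1 h; have := yP k (y k).
by rewrite h lexx => ?; lra.
Qed.

(** An end of the window may stay at bounded distance from [r k], so each inequality is stated
    locally: the subsolution property at [x] only asks that points just left of [x] eventually avoid
    the right end, the supersolution property that they avoid the left end. *)
Let recentred_limit (r : nat -> R) : exists phi : R -> R, [/\ inM phi,
  forall x p, p < x -> (forall t : R, p < t < x -> \forall k \near U,
    t + r k <= (nk k)%:R) -> phi x <= Qs c phi x,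
  forall x p, p < x -> (forall t : R, p < t < x -> \forall k \near U,
    - (nk k)%:R < t + r k) -> Qs c phi x <= phi x,
  forall a x p, 0 <= a <= 1 -> p < x -> (forall t : R, p < t < x ->
    \forall k \near U, uk k (t + r k) <= a) -> phi x <= a &
  forall a x p, 0 <= a <= 1 -> p < x -> (forall t : R, p < t < x ->
    \forall k \near U, a <= uk k (t + r k)) -> a <= phi x].
Proof.
pose w k := transl (- r k) (uk k).
have wM k : inM (w k) by exact: inM_transl.
have wE k x : w k x = uk k (x + r k) by rewrite /w /transl opprK.
have PwE k x : Qs (s k) (w k) x = Qs (s k) (uk k) (x + r k).
  by rewrite /w Qs_transl // /transl opprK.
have [phi phiM wphi] := helly UU wM.
have Pwphi := Qs_wcvg wM phiM wphi sc.
have PphiM := inM_Qs c phiM.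
exists phi; split=> //.
- move=> x p px h; apply: (wcvg_le_near UU wphi Pwphi phiM PphiM px) => t /h.
  by apply: filterS => k; rewrite wE PwE; case: (ukT k) => _ _ _ + _; apply.
- move=> x p px h; apply: (wcvg_le_near UU Pwphi wphi PphiM phiM px) => t /h.
  by apply: filterS => k; rewrite wE PwE; case: (ukT k) => _ _ _ _; apply.
- move=> a x p /inM_cst aM px h.
  apply: (wcvg_le_near UU wphi (wcvg_cst UU aM) phiM aM px) => t /h.
  by apply: filterS => k; rewrite wE.
- move=> a x p /inM_cst aM px h.
  apply: (wcvg_le_near UU (wcvg_cst UU aM) wphi aM phiM px) => t /h.
  by apply: filterS => k; rewrite wE.
Qed.

(* If the two levels drifted apart, recentring at either one would yield
   stacked waves of the same speed. *)
Lemma levels_gap : exists A : R, \forall k \near U, y k - z k <= A.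
Proof.
have [h1 h2] := bb'; apply: contrapT => nA.
have gap A : \forall k \near U, A < y k - z k.
  apply: contrapT => /(ultra_not UU) h; apply: nA; exists A.
  by apply: filterS h => k /negP; rewrite -leNgt.
apply: (@no_stacked_waves c).
(* Seen from [z k] the crossing [y k], and with it the right end, recedes to infinity: [phi] is a
   subsolution everywhere and stays below [b']. Its right limit, being less than 1, is then at most
   [alpha]. *)
- have [phi [phiM sub super le ge]] := recentred_limit z.
  have phisub x : phi x <= Qs c phi x.
    apply: (sub x (x - 1)) => [|t _]; first by lra.
    by apply: filterS (gap t) => k; have := levels k; lra.
  have phisuper x : 0 < x -> Qs c phi x <= phi x.
    move=> x0; apply: (super x 0) => // t t0.
    by apply: near_all => k; have := levels k; lra.
  have phib' x : phi x <= b'.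
    apply: (le b' x (x - 1)) => [||t _]; [lra|lra|].
    by apply: filterS (gap t) => k; rewrite yP; lra.
  have phib : phi 0 <= b.
    apply: (le b 0 (-1)) => [||t t0]; [lra|lra|].
    by apply: near_all => k; rewrite zP; lra.
  have bphi : b <= phi 1.
    apply: (ge b 1 0) => [||t t0]; [lra|lra|].
    by apply: near_all => k; apply/ltW; rewrite ltNge zP; lra.
  apply: (wave_below (psi := phi) (x0 := 0) (x1 := 1)) => //; last 2 first.
    by lra.
    by lra.
  move=> x; have [l phil l01] := right_limit_ex phiM.
  apply: (le_trans (phil.1 x)).
  apply: (right_limit_super (X := 0) phiM l01 phil phisuper).
  rewrite ltNge; apply/negP => l1.
  by have [|x' hx'] := phil.2 (1 - b'); [lra|have := phib' x'; lra].
(* Symmetrically, seen from [y k] the left end recedes and [phi] stays above [b], hence above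
   [alpha]. *)
- have [phi [phiM sub super le ge]] := recentred_limit y.
  have phisuper x : Qs c phi x <= phi x.
    apply: (super x (x - 1)) => [|t _]; first by lra.
    by apply: filterS (gap (- t)) => k; have := levels k; lra.
  have phisub x : x <= 0 -> phi x <= Qs c phi x.
    move=> x0; apply: (sub x (x - 1)) => [|t tx]; first by lra.
    by apply: near_all => k; have := levels k; lra.
  have bphi x : b <= phi x.
    apply: (ge b x (x - 1)) => [||t _]; [lra|lra|].
    apply: filterS (gap (- t)) => k ?; apply/ltW; rewrite ltNge zP; lra.
  have phib' : phi 0 <= b'.
    apply: (le b' 0 (-1)) => [||t t0]; [lra|lra|].
    by apply: near_all => k; rewrite yP; lra.
  have b'phi : b' <= phi 1.
    apply: (ge b' 1 0) => [||t t0]; [lra|lra|].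
    by apply: near_all => k; apply/ltW; rewrite ltNge yP; lra.
  apply: (wave_above (psi := phi) (x0 := 1) (x1 := 0)) => //; last 2 first.
    by lra.
    by lra.
  move=> x; have [l phil l01] := left_limit_ex phiM.
  apply: le_trans (phil.1 x).
  apply: (left_limit_sub (X := 0) phiM l01 phil phisub).
  rewrite ltNge; apply/negP => l0.
  by have [|x' hx'] := phil.2 b; [lra|have := bphi x'; lra].
Qed.

(** As [z k <= 0], the right end recedes from [z k], so the limit is a subsolution everywhere. The
    bounded gap brings it above [b'], which forces the right limit 1. *)
Lemma subsolution_front : (forall k, z k <= 0) -> exists phi, [/\ inM phi,
  forall x, phi x <= Qs c phi x, left_limit phi 0, right_limit phi 1 &
  (forall x, Qs c phi x <= phi x) \/ exists B, forall x, x <= B -> phi x = 0].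
Proof.
have [h1 h2] := bb' => z0; have [A hA] := levels_gap.
have [phi [phiM sub super le ge]] := recentred_limit z.
have phisub x : phi x <= Qs c phi x.
  apply: (sub x (x - 1)) => [|t _]; first by lra.
  by apply: filterS (nkoo t) => k; have := z0 k; lra.
have phisuper x : 0 < x -> Qs c phi x <= phi x.
  move=> x0; apply: (super x 0) => // t t0.
  by apply: near_all => k; have := levels k; lra.
have phib : phi 0 <= b.
  apply: (le b 0 (-1)) => [||t t0]; [lra|lra|].
  by apply: near_all => k; rewrite zP; lra.
have b'phi : b' <= phi (A + 1).
  apply: (ge b' (A + 1) A) => [||t t0]; [lra|lra|].
  by apply: filterS hA => k ?; apply/ltW; rewrite ltNge yP; lra.
exists phi; split=> //.
- have [l phil l01] := left_limit_ex phiM.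
  rewrite (_ : 0 = l) //; apply/eqP; rewrite eq_le; apply/andP; split; first by lra.
  rewrite leNgt; apply/negP.
  move=> /(left_limit_sub (X := 0) (c := c) phiM l01 phil) h.
  by have := phil.1 0; have := h (fun x _ => phisub x); lra.
- have [l phil l01] := right_limit_ex phiM.
  rewrite (_ : 1 = l) //; apply/eqP; rewrite eq_le; apply/andP; split; last by lra.
  rewrite leNgt; apply/negP.
  move=> /(right_limit_super (X := 0) (c := c) phiM l01 phil phisuper).
  by have := phil.1 (A + 1); lra.
(* Either the left end recedes too and [phi] is a wave, or it stays to the right of some [B] in the
   recentred frame and the imposed value 0 survives in the limit. *)
- have [far|] := pselect (forall B, \forall k \near U, - (nk k)%:R - z k < B).
    left=> x; apply: (super x (x - 1)) => [|t _]; first by lra.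
    by apply: filterS (far t) => k; lra.
  move=> /existsNP [B /(ultra_not UU) hB]; right; exists B => x xB.
  apply/eqP; rewrite eq_le (inM_ge0 phiM) andbT.
  apply: (le 0 x (x - 1)) => [||t tx]; [lra|lra|].
  apply: filterS hB => k /negP; rewrite -leNgt => hk.
  by case: (ukT k) => _ -> //; lra.
Qed.

(** Symmetric to [subsolution_front]: [0 <= y k] keeps the left end far away, and the right end
    either recedes or leaves the value 1 in the limit. *)
Lemma supersolution_front : (forall k, 0 <= y k) -> exists phi, [/\ inM phi,
  forall x, Qs c phi x <= phi x, left_limit phi 0, right_limit phi 1 &
  (forall x, phi x <= Qs c phi x) \/ exists B, forall x, B < x -> phi x = 1].
Proof.
have [h1 h2] := bb' => y0; have [A hA] := levels_gap.
have [phi [phiM sub super le ge]] := recentred_limit y.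
have phisuper x : Qs c phi x <= phi x.
  apply: (super x (x - 1)) => [|t _]; first by lra.
  by apply: filterS (nkoo (- t)) => k; have := y0 k; lra.
have phisub x : x <= 0 -> phi x <= Qs c phi x.
  move=> x0; apply: (sub x (x - 1)) => [|t tx]; first by lra.
  by apply: near_all => k; have := levels k; lra.
have phib : phi (- A) <= b.
  apply: (le b (- A) (- A - 1)) => [||t t0]; [lra|lra|].
  by apply: filterS hA => k ?; rewrite zP; lra.
have b'phi : b' <= phi 1.
  apply: (ge b' 1 0) => [||t t0]; [lra|lra|].
  by apply: near_all => k; apply/ltW; rewrite ltNge yP; lra.
exists phi; split=> //.
- have [l phil l01] := left_limit_ex phiM.
  rewrite (_ : 0 = l) //; apply/eqP; rewrite eq_le; apply/andP; split; first by lra.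
  rewrite leNgt; apply/negP.
  move=> /(left_limit_sub (X := 0) (c := c) phiM l01 phil phisub).
  by have := phil.1 (- A); lra.
- have [l phil l01] := right_limit_ex phiM.
  rewrite (_ : 1 = l) //; apply/eqP; rewrite eq_le; apply/andP; split; last by lra.
  rewrite leNgt; apply/negP.
  move=> /(right_limit_super (X := 0) (c := c) phiM l01 phil) h.
  by have := phil.1 1; have := h (fun x _ => phisuper x); lra.
- have [far|] := pselect (forall B, \forall k \near U, B <= (nk k)%:R - y k).
    left=> x; apply: (sub x (x - 1)) => [|t _]; first by lra.
    by apply: filterS (far t) => k; lra.
  move=> /existsNP [B /(ultra_not UU) hB]; right; exists B => x xB.
  apply/eqP; rewrite eq_le (inM_le1 phiM) /=.
  apply: (ge 1 x B) => [||t tx]; [lra|lra|].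
  apply: filterS hB => k /negP; rewrite -ltNge => hk.
  by case: (ukT k) => _ _ -> //; lra.
Qed.

End TruncatedFamily.

(** * Choice of the speed and construction of the wave *)

Lemma truncated_levels c n u b : truncated c n u -> 0 < b < 1 ->
  exists z, forall x, (u x <= b) = (x <= z).
Proof.
move=> [uM u0 u1 _ _] b01; apply: inM_crossing => //.
  by exists (- n%:R); rewrite u0; lra.
by exists (n%:R + 1); rewrite u1; lra.
Qed.

Lemma wave_between c phi psi : inM phi -> inM psi ->
  (forall x, phi x <= Qs c phi x) -> (forall x, Qs c psi x <= psi x) ->
  (forall x, phi x <= psi x) -> left_limit psi 0 -> right_limit phi 1 ->
  wave c 0 1.
Proof.
move=> phiM psiM phiP Ppsi phipsi [_ psi0] [_ phi1].
have [u [uM uP phiu upsi]] := fixpoint_between (@inM_Qs c)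
  (fun w w' wM w'M ww' x => Qs_le c x wM w'M ww') phiM psiM phipsi phiP Ppsi.
exists u; split=> //; split.
- exact: inM_ge0.
- by move=> e /psi0 [x hx]; exists x; have := upsi x; lra.
- exact: inM_le1.
- by move=> e /phi1 [x hx]; exists x; have := phiu x; lra.
Qed.

(** The speed is the supremum of those admitting a window solution above [b] at 0. By sliding, this
    set contains all speeds below [cl] and none above [cu]. *)
Lemma truncated_speeds cl psil cu psiu b n : inM psil -> psil 0 = 0 ->
  (forall x, psil x <= Qs cl psil x) -> b < psil n%:R ->
  inM psiu -> psiu 0 = 1 -> (forall x, Qs cu psiu x <= psiu x) ->
  psiu (- n%:R) <= b -> forall e, 0 < e ->
  exists c, cl <= c <= cu /\ exists cm cp um up,
    [/\ `|cm - c| <= e, `|cp - c| <= e, truncated cm n um /\ b < um 0 &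
        truncated cp n up /\ up 0 <= b].
Proof.
move=> psilM psil0 psilP bpsil psiuM psiu0 Ppsiu psiub e e0.
pose S := [set c | exists u, truncated c n u /\ b < u 0].
have below c : c < cl -> S c.
  move=> ccl; have [u uT] := truncated_ex c n; exists u; split=> //.
  have := truncated_ge uT ccl psilM psil0 psilP 0.
  by rewrite add0r; exact: lt_le_trans.
have above : ubound S cu.
  move=> c [u [uT bu]]; rewrite leNgt; apply/negP => cuc.
  have := truncated_le uT cuc psiuM psiu0 Ppsiu 0; rewrite add0r.
  by lra.
have hS : has_sup S by split; [exists (cl - 1); apply: below; lra|exists cu].
have Sle c : S c -> c <= sup S by move=> ?; apply: ub_le_sup => //; exists cu.
have [cm [um [umT bum]] hcm] := sup_adherent e0 hS.
(* [sup S + e] is outside [S], so any window solution of that speed is at most [b] at 0. *)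
have [up upT] := truncated_ex (sup S + e) n.
exists (sup S); split.
  apply/andP; split; last by apply: ge_sup => //; exact: hS.1.
  by rewrite leNgt; apply/negP => h; have := Sle _ (below ((sup S + cl) / 2) _); lra.
exists cm, (sup S + e), um, up; split=> //.
- by have := Sle cm (ex_intro _ um (conj umT bum)); rewrite ler_norml; lra.
- by rewrite ler_norml; lra.
- split=> //; rewrite leNgt; apply/negP => bup.
  by have := Sle (sup S + e) (ex_intro _ up (conj upT bup)); lra.
Qed.

Lemma bistable_wave cl psil l cu psiu l' : inM psil -> psil 0 = 0 ->
  (forall x, psil x <= Qs cl psil x) -> right_limit psil l -> alpha < l ->
  inM psiu -> psiu 0 = 1 -> (forall x, Qs cu psiu x <= psiu x) ->
  left_limit psiu l' -> l' < alpha ->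
  exists2 c, cl <= c <= cu & wave c 0 1.
Proof.
move=> psilM psil0 psilP psill al psiuM psiu0 Ppsiu psiul l'a.
have a01 := alpha01.
(* Being between [l'] and [alpha < l], the level [b] is reached from above by [psiu] and exceeded by
   [psil]. Windows of half-length at least [N] see both. *)
pose b := (Num.max 0 l' + alpha) / 2; pose b' := (1 + alpha) / 2.
have bb' : 0 < b < alpha /\ alpha < b' < 1.
  by rewrite /b /b' maxEle; case: ifP; lra.
have l'b : l' < b by rewrite /b maxEle; case: ifP; lra.
have [x1 hx1] : exists x, b < psil x.
  by have [|x hx] := psill.2 (l - b); [|exists x]; lra.
have [x2 hx2] : exists x, psiu x <= b.
  by have [|x hx] := psiul.2 (b - l'); [|exists x]; lra.
have [N hN] := filter_ex (nbhs_infty_gtr (Num.max x1 (- x2))).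
have N1 : x1 <= N%:R by move: hN; rewrite /= gt_max; lra.
have N2 : - N%:R <= x2 by move: hN; rewrite /= gt_max; lra.
have /choice[c /all_and2 [ccl /choice[cm /choice[cp /choice[um /choice[up h]]]]]] k :
    exists c, cl <= c <= cu /\ exists cm cp um up,
    [/\ `|cm - c| <= k.+1%:R^-1, `|cp - c| <= k.+1%:R^-1,
        truncated cm (N + k) um /\ b < um 0 &
        truncated cp (N + k) up /\ up 0 <= b].
  have kN : N%:R <= (N + k)%:R :> R by rewrite ler_nat leq_addr.
  apply: (truncated_speeds psilM psil0 psilP _ psiuM psiu0 Ppsiu).
  - by apply: lt_le_trans hx1 _; apply: (inM_ndecr psilM); lra.
  - by apply: le_trans hx2; apply: (inM_ndecr psiuM); lra.
  - by rewrite invr_gt0 ltr0Sn.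
have [cs ccs csI] : exists2 cs, ucvg U c cs & cl <= cs <= cu.
  by apply: (ucvg_bounded UU); exact: near_all.
exists cs => //.
have nkoo (A : R) : \forall k \near U, A < (N + k)%:R.
  apply: filterS (ooU (nbhs_infty_gtr A)) => k /= /lt_le_trans; apply.
  by rewrite ler_nat leq_addl.
have umT k : truncated (cm k) (N + k) (um k) by have [_ _ []] := h k.
have upT k : truncated (cp k) (N + k) (up k) by have [_ _ _ []] := h k.
have cmcs : ucvg U cm cs by apply: (ucvg_dist UU ooU _ ccs) => k; case: (h k).
have cpcs : ucvg U cp cs by apply: (ucvg_dist UU ooU _ ccs) => k; case: (h k).
have b01 : 0 < b < 1 by lra.
have b'01 : 0 < b' < 1 by lra.
have /choice[zm zmP] k := truncated_levels (umT k) b01.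
have /choice[ym ymP] k := truncated_levels (umT k) b'01.
have /choice[zp zpP] k := truncated_levels (upT k) b01.
have /choice[yp ypP] k := truncated_levels (upT k) b'01.
have zm0 k : zm k <= 0.
  by apply/ltW; rewrite ltNge -zmP -ltNge; have [_ _ []] := h k.
have yp0 k : 0 <= yp k.
  by rewrite -ypP; have [_ _ _ [_ ]] := h k; lra.
have [phi [phiM phisub phi0 phi1 phic]] :=
  subsolution_front bb' cmcs nkoo umT zmP ymP zm0.
have [psi [psiM psisuper psi0 psi1 psic]] :=
  supersolution_front bb' cpcs nkoo upT zpP ypP yp0.
case: phic => [phisuper|[B1 hB1]].
  exact: (wave_between phiM phiM).
case: psic => [psisub|[B2 hB2]].
  exact: (wave_between psiM psiM).
(* This translate of [psi] equals 1 right of [B1], while [phi] vanishes up to [B1]; hence it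
   dominates [phi]. *)
have tM := inM_transl (B1 - B2) psiM.
apply: (wave_between phiM tM) => //.
- by move=> x; rewrite Qs_transl //; exact: psisuper.
- move=> x; have [/hB1 ->|xB] := leP x B1; first exact: inM_ge0.
  by rewrite /transl hB2; [exact: inM_le1|lra].
- split=> [x|e]; first exact: inM_ge0.
  by case: psi0 => _ /[apply] -[x hx]; exists (x + (B1 - B2)); rewrite /transl addrK.
Qed.

End BistableWaves.

Theorem theorem4 (R : realType) (Q0 : (R -> R) -> (R -> R)) (alpha : R)
  (hQM : forall u, inM u -> inM (Q0 u))
  (halpha : 0 < alpha < 1)
  (hi : forall (uk : nat -> R -> R) (u : R -> R),
      (forall k, inM (uk k)) -> inM u -> unif_cvg_bounded uk u ->
      {ae (@lebesgue_measure R), forall x, Q0 (uk k) x @[k --> \oo] --> Q0 u x})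
  (hii : forall u1 u2, inM u1 -> inM u2 -> (forall x, u1 x <= u2 x) ->
      forall x, Q0 u1 x <= Q0 u2 x)
  (hiii : forall (x0 : R) u, inM u -> transl x0 (Q0 u) = Q0 (transl x0 u))
  (hiv1 : Q0 (fun _ => alpha) = (fun _ => alpha))
  (hiv2 : forall gamma : R, 0 < gamma < alpha -> forall x, Q0 (fun _ => gamma) x < gamma)
  (hiv3 : forall gamma : R, alpha < gamma < 1 -> forall x, gamma < Q0 (fun _ => gamma) x)
  (hv : forall (cm cp : R) (phim phip : R -> R), inM phim -> inM phip ->
      (forall x, Q0 phim (x - cm) = phim x) -> lim_minf phim 0 -> lim_pinf phim alpha ->
      (forall x, Q0 phip (x - cp) = phip x) -> lim_minf phip alpha -> lim_pinf phip 1 ->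
      cm < cp)
  (cl : R) (psil : R -> R) (hpsilM : inM psil) (hpsil0 : psil 0 = 0)
  (hpsilinf : exists l : R, lim_pinf psil l /\ alpha < l <= 1)
  (hpsilsub : forall x, psil x <= Q0 psil (x - cl))
  (cu : R) (psiu : R -> R) (hpsiuM : inM psiu) (hpsiu0 : psiu 0 = 1)
  (hpsiuinf : exists l : R, lim_minf psiu l /\ 0 <= l < alpha)
  (hpsiusup : forall x, Q0 psiu (x - cu) <= psiu x) :
  exists c : R, cl <= c <= cu /\
    exists phi : R -> R, inM phi /\ lim_minf phi 0 /\ lim_pinf phi 1 /\
      forall x, Q0 phi (x - c) = phi x.
Proof.
(* Refining [\oo] makes [U] nonprincipal, so whatever holds for all large [k] holds along [U]. *)
have [U [UU ooU]] := @ultraFilterLemma nat \oo _.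
have wQ := wcvg_preserved UU hQM hi hii hiii.
have nowaves c : wave Q0 c 0 alpha -> wave Q0 c alpha 1 -> False.
  move=> [phim [mM mE m0 m1]] [phip [pM pE p0 p1]].
  suff : c < c by rewrite ltxx.
  apply: (hv c c phim phip) => //.
  - exact/lim_minf_left_limit.
  - exact/lim_pinf_right_limit.
  - exact/lim_minf_left_limit.
  - exact/lim_pinf_right_limit.
have [l [/lim_pinf_right_limit psill /andP[al _]]] := hpsilinf.
have [l' [/lim_minf_left_limit psiul /andP[_ l'a]]] := hpsiuinf.
have [c cI [phi [phiM phiE phi0 phi1]]] := bistable_wave UU ooU hQM hii hiii wQ
  halpha hiv1 hiv2 hiv3 nowaves hpsilM hpsil0 hpsilsub (psill hpsilM) al
  hpsiuM hpsiu0 hpsiusup (psiul hpsiuM) l'a.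
exists c; split=> //; exists phi; split=> //.
split; first exact/lim_minf_left_limit.
by split=> //; exact/lim_pinf_right_limit.
Qed.
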